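(* Let $a,b:\mathbb{N}\to[-1,1]$ be functions with $a(n)\le 0\le b(n)$ for all $n\in\mathbb{N}$ and $\sum_{n}\max\{-a(n),b(n)\}=\infty$. Then there exists a homeomorphism $F:B^+(\mathbb{N})\to B(\mathbb{N},a,b)$ such that $\sum_n|F(x)_n|=\sum_n x_n$ for all $x\in B^+(\mathbb{N})$.
   Context: $B^+(\mathbb{N})=\{x\in[0,1]^{\mathbb{N}}:\sum_n x_n\le 1\}$ and $B(\mathbb{N},a,b)=\{x\in\mathbb{R}^{\mathbb{N}}:\sum_n|x_n|\le 1,\ a(n)\le x_n\le b(n)\text{ for all }n\in\mathbb{N}\}$, both with the topology inherited from the product topology (pointwise convergence of coordinates). *)

(* Defs.v *)
From mathcomp Require Import all_boot all_order all_algebra.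
From mathcomp Require Import all_classical all_reals all_analysis.
Import Order.TTheory GRing.Theory Num.Theory.
Import numFieldNormedType.Exports.

Set Implicit Arguments.
Unset Strict Implicit.
Unset Printing Implicit Defensive.

Local Open Scope classical_set_scope.
Local Open Scope ring_scope.
Local Open Scope ereal_scope.

Definition homeomorphism (S T : topologicalType) (f : S -> T) : Prop :=
  exists g : T -> S,
    [/\ cancel f g, cancel g f, continuous f & continuous g].

(* The sums below have nonnegative terms and are taken in \bar R, so a bound
   by 1 includes convergence. The coercion of a set to a type carries the
   subspace topology, here that of pointwise convergence. *)
Definition Bplus (R : realType) : set {ptws nat -> R} :=
  [set x | (forall n, (0 <= x n <= 1)%R) /\
           \sum_(0 <= n <oo) (x n)%:E <= 1].

Arguments Bplus R : clear implicits.

Definition Bab (R : realType) (a b : nat -> R) : set {ptws nat -> R} :=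
  [set x | \sum_(0 <= n <oo) `|x n|%:E <= 1 /\
           (forall n, (a n <= x n <= b n)%R)].

(* Main.v *)
Require Import Defs.
From mathcomp Require Import all_boot all_order all_algebra.
From mathcomp Require Import all_classical all_reals all_analysis.
From mathcomp Require Import ring lra zify.
Import Order.TTheory GRing.Theory Num.Theory.
Import numFieldNormedType.Exports.

Set Implicit Arguments.
Unset Strict Implicit.
Unset Printing Implicit Defensive.

Local Open Scope classical_set_scope.
Local Open Scope ring_scope.

(** Up to a sign in each coordinate the target interval is [[-q n, p n]] with
    [0 <= q n <= p n <= 1] and [\sum p = +oo].  The mass of [x] is processed
    through a queue: at stage [n] the carried mass [z] meets one new coordinate
    [f] of [x], the value [w = mix p q z f] is emitted, and [z + f - |w|] is
    carried on.  For fixed [r = z + f] the segment of pairs [(z, f)] is mapped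
    affinely onto [[- min q r, min p r]], the end [f = 0] going to [min p r].
    - The emitted mass plus the carry equals the mass received, and
      [\sum p n * carry n <= 2], so the carry tends to 0 and the norm is
      preserved.
    - Two stages emitting the same [w] have [z] and [f] ordered as [r] is; so the
      distance between the carries of two inputs with equal images is
      nondecreasing in [n], and as it tends to 0 it vanishes: injectivity.
    - Stages can be inverted backwards from carry 0, so every finite prefix is
      attained; with compactness this gives surjectivity and the continuity of
      the inverse. *)

(** * Subspaces and compact-to-Hausdorff maps *)

Lemma compact_set_type (X : topologicalType) (A : set X) :
  compact A -> compact [set: A].
Proof.
move=> cA F FF _.
have FA : (val @ F) A by apply: (@filterE _ F) => u; exact: set_valP.
have [p [Ap Fp]] := cA _ _ FA.
exists (exist _ p (mem_set Ap)); split=> // B C FB [_ [[D oD <-] /= Dp DC]].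
have FvB : (val @ F) (val @` B) by apply: (@filterS _ F _ B) FB => u Bu; exists u.
have [_ [[u Bu <-] Du]] := Fp _ _ FvB (open_nbhs_nbhs (conj oD Dp)).
by exists u; split=> //; exact: DC.
Qed.

Lemma hausdorff_set_type (X : topologicalType) (A : set X) :
  hausdorff_space X -> hausdorff_space A.
Proof.
move=> hX u v uv; apply/val_inj/hX => B C /(@initial_continuous _ _ val u) uB.
move=> /(@initial_continuous _ _ val v) vC.
by have [w []] := uv _ _ uB vC; exists (val w).
Qed.

Lemma continuous_set_type (S X : topologicalType) (A : set X) (f : S -> A) :
  continuous (val \o f) -> continuous f.
Proof.
move=> cf; apply/continuousP => _ [B oB <-].
exact: (iffLR (continuousP (val \o f)) cf).
Qed.

(** Closed subsets of [S] are compact, so [f] sends them to compact, hence closed, sets; these are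
    the preimages under [g]. *)
Lemma homeomorphism_compact_hausdorff (S T : topologicalType) (f : S -> T) :
  compact [set: S] -> hausdorff_space T -> continuous f -> bijective f ->
  homeomorphism f.
Proof.
move=> cS hT cf [g fK gK]; exists g; split=> //.
apply/continuous_closedP => B cB.
suff -> : g @^-1` B = f @` B.
  apply: compact_closed => //; apply: continuous_compact.
    exact: continuous_subspaceT.
  exact: subclosed_compact cB cS _.
by apply/seteqP; split=> [t /= Bt|_ [s Bs <-] /=]; [exists (g t)|rewrite fK].
Qed.

(** * The map of a single stage *)

(** For [0 < c] and [0 < r] this is [min c r / r]; the maximum in the denominator removes the
    singularity at [r = 0]. For [c = 0] it is constantly 0, division by zero included. *)
Definition share (R : realFieldType) (c r : R) : R := c / Num.max c r.

(* With [r = z + x], [z / r] and [x / r] the barycentric weights, this is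
   [(z / r) * min p r - (x / r) * min q r], written so that it stays continuous
   at [r = 0]. *)
Definition mix (R : realFieldType) (p q z x : R) : R :=
  z * share p (z + x) - x * share q (z + x).

Lemma share0 (R : realFieldType) (r : R) : share 0 r = 0.
Proof. by rewrite /share mul0r. Qed.

Lemma share_gt0 (R : realFieldType) (c r : R) : 0 < c -> 0 < share c r.
Proof. by move=> c0; rewrite divr_gt0// lt_max c0. Qed.

Lemma share_ge0 (R : realFieldType) (c r : R) : 0 <= c -> 0 <= share c r.
Proof. by move=> c0; rewrite divr_ge0// le_max c0. Qed.

Lemma share_le1 (R : realFieldType) (c r : R) : 0 <= c -> share c r <= 1.
Proof.
rewrite le_eqVlt => /predU1P[<-|c0]; first by rewrite share0.
by rewrite ler_pdivrMr ?lt_max ?c0// mul1r le_max lexx.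
Qed.

Lemma mul_share (R : realFieldType) (c r : R) :
  0 <= c -> 0 <= r -> r * share c r = Num.min c r.
Proof.
move=> c0 r0; rewrite /share; case: (leP c r) => [cr|/ltW rc].
  have [rE|rN0] := eqVneq r 0; last by rewrite mulrC divfK.
  by apply/le_anti; rewrite rE mul0r c0 -rE cr.
have [cE|cN0] := eqVneq c 0; last by rewrite mulfV// mulr1.
by apply/le_anti; rewrite cE mul0r mulr0 r0 -cE rc.
Qed.

Lemma share_anti (R : realFieldType) (c r s : R) :
  0 <= c -> r <= s -> share c s <= share c r.
Proof.
rewrite le_eqVlt => /predU1P[<-|c0] rs; first by rewrite !share0.
rewrite ler_pM2l// lef_pV2 ?posrE ?lt_max ?c0// ge_max !le_max lexx/=.
by rewrite rs orbT.
Qed.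

Lemma share_ge (R : realFieldType) (c r : R) :
  0 <= c <= 1 -> r <= 1 -> c <= share c r.
Proof.
move=> /andP[]; rewrite le_eqVlt => /predU1P[<-|c0] c1 r1.
  by rewrite share0.
by rewrite ler_pdivlMr ?lt_max ?c0// ger_pMr// ge_max c1.
Qed.

(** Without its subtracted term [mix] is [z * share p (z + x)]: at most [z] because a share is at
    most 1, and at most [(z + x) * share p (z + x)], hence at most [p]. *)
Lemma mix_le (R : realFieldType) (p q z x : R) :
  0 <= p -> 0 <= q -> 0 <= z -> 0 <= x -> mix p q z x <= Num.min p z.
Proof.
move=> p0 q0 z0 x0; have zx : 0 <= z + x by exact: addr_ge0.
have sp := share_ge0 (z + x) p0; have sq := share_ge0 (z + x) q0.
have sp1 := share_le1 (z + x) p0.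
have : (z + x) * share p (z + x) <= p by rewrite mul_share// ge_min lexx.
rewrite le_min /mix => ?; apply/andP; split; nra.
Qed.

(** This symmetry turns the upper bounds of [mix_le] into lower bounds. *)
Lemma mixC (R : realFieldType) (p q z x : R) :
  mix q p x z = - mix p q z x.
Proof. by rewrite /mix opprB (addrC x z). Qed.

Lemma mix_norm (R : realFieldType) (p q z x : R) :
  0 <= p -> 0 <= q -> 0 <= z -> 0 <= x -> `|mix p q z x| <= z + x.
Proof.
move=> p0 q0 z0 x0; rewrite ler_norml.
have := mix_le p0 q0 z0 x0; have := mix_le q0 p0 x0 z0.
by rewrite mixC !le_min => /andP[_ ?] /andP[_ ?]; lra.
Qed.

(** A large carry forces a large emission, up to the new coordinate; this is what bounds the
    weighted sum of carries. *)
Lemma mix_ge (R : realFieldType) (p q z x : R) :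
  0 <= p <= 1 -> 0 <= q -> 0 <= z -> 0 <= x -> z + x <= 1 ->
  z * p - x <= mix p q z x.
Proof.
move=> p01 q0 z0 x0 zx1; rewrite lerB//; last first.
  by rewrite ler_piMr// share_le1.
by rewrite ler_wpM2l// share_ge.
Qed.

(** With [r = z + x] and [w] the common value, [z * (share p r + share q r) = w + r * share q r].
    The right side grows with [r] while the factor of [z] shrinks, so [z] grows. For [x] the right
    side is [r * share p r - w]. *)
Lemma mix_mono (R : realFieldType) (p q z x z' x' : R) :
  0 < p -> 0 <= q -> 0 <= z -> 0 <= x -> 0 <= z' -> 0 <= x' ->
  mix p q z x = mix p q z' x' -> z + x <= z' + x' ->
  z <= z' /\ x <= x'.
Proof.
move=> p0 q0 z0 x0 z'0 x'0; rewrite /mix => E rr'.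
have r0 : 0 <= z + x by exact: addr_ge0.
have r'0 : 0 <= z' + x' by exact: addr_ge0.
have p0' := ltW p0.
have mp : (z + x) * share p (z + x) <= (z' + x') * share p (z' + x').
  by rewrite !mul_share// le_min !ge_min lexx rr' orbT.
have mq : (z + x) * share q (z + x) <= (z' + x') * share q (z' + x').
  by rewrite !mul_share// le_min !ge_min lexx rr' orbT.
have sp := share_gt0 (z + x) p0; have sq := share_ge0 (z + x) q0.
have ap := share_anti p0' rr'; have aq := share_anti q0 rr'.
have s0 : 0 < share p (z + x) + share q (z + x) by lra.
split; rewrite -(ler_pM2r s0); nra.
Qed.

Lemma mix_surj (R : realFieldType) (p q w s : R) :
  0 < p -> 0 <= q -> - q <= w <= p -> 0 <= s ->
  exists z x, [/\ 0 <= z, 0 <= x, mix p q z x = w & z + x = `|w| + s].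
Proof.
move=> p0 q0 /andP[qw wp] s0; set r : R := `|w| + s.
have r0 : 0 <= r by rewrite addr_ge0.
have /andP[rw wr] : - r <= w <= r by rewrite -ler_norml /r lerDl.
have sp := share_gt0 r p0; have sq := share_ge0 r q0.
have D0 : 0 < share p r + share q r by lra.
(* Once [r] is fixed, [z + x = r] and [mix p q z x = w] are two linear equations in [z] and [x];
   this is their solution. *)
exists ((w + r * share q r) / (share p r + share q r)).
exists ((r * share p r - w) / (share p r + share q r)).
have E : (w + r * share q r) / (share p r + share q r) +
         (r * share p r - w) / (share p r + share q r) = r.
  by field; rewrite gt_eqF.
split=> //.
- by rewrite divr_ge0 ?(ltW D0)// mul_share//; case: (leP q r) => _; lra.
- rewrite divr_ge0 ?(ltW D0)// mul_share ?(ltW p0)//.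
  by case: (leP p r) => _; lra.
- by rewrite /mix E; field; rewrite gt_eqF.
Qed.

(** * The queue and its mass balance *)

Definition rank (R : realFieldType) (p : nat -> R) (n : nat) : nat :=
  (\sum_(i < n) (p i != 0%R))%N.

(* Stages with [p n = 0] can only emit 0, so they must not consume a coordinate:
   [rank p n] counts the coordinates other than [x 0] consumed before stage [n]. *)
Definition feed (R : realFieldType) (p x : nat -> R) (n : nat) : R :=
  if p n == 0 then 0 else x (rank p n).+1.

Fixpoint carry (R : realFieldType) (p q x : nat -> R) (n : nat) : R :=
  if n is m.+1 then
    carry p q x m + feed p x m
    - `|mix (p m) (q m) (carry p q x m) (feed p x m)|
  else x 0.

Definition emit (R : realFieldType) (p q x : nat -> R) (n : nat) : R :=
  mix (p n) (q n) (carry p q x n) (feed p x n).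

Definition caps (R : realFieldType) (p q : nat -> R) : Prop :=
  forall n, [/\ 0 <= q n, q n <= p n & p n <= 1].

Definition submass (R : realFieldType) (x : nat -> R) : Prop :=
  (forall n, 0 <= x n) /\ forall n, \sum_(i < n) x i <= 1.

Definition unbounded_sum (R : realFieldType) (p : nat -> R) : Prop :=
  forall A : R, exists n, A < \sum_(i < n) p i.

Lemma caps_ge0 (R : realFieldType) (p q : nat -> R) n :
  caps p q -> 0 <= p n.
Proof. by move=> /(_ n)[q0 /(le_trans q0)]. Qed.

Lemma rankS (R : realFieldType) (p : nat -> R) n :
  rank p n.+1 = (rank p n + (p n != 0%R))%N.
Proof. by rewrite /rank big_ord_recr. Qed.

Lemma rank_homo (R : realFieldType) (p : nat -> R) (m n : nat) :
  (m <= n)%N -> (rank p m <= rank p n)%N.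
Proof.
move=> /subnKC <-; elim: (n - m)%N => [|k]; first by rewrite addn0.
by rewrite addnS rankS => /leq_trans; apply; exact: leq_addr.
Qed.

Lemma feed_ge0 (R : realFieldType) (p x : nat -> R) n :
  (forall i, 0 <= x i) -> 0 <= feed p x n.
Proof. by rewrite /feed; case: eqP. Qed.

Lemma carry_ge0 (R : realFieldType) (p q x : nat -> R) n :
  caps p q -> (forall i, 0 <= x i) -> 0 <= carry p q x n.
Proof.
move=> pq x0; elim: n => [|n IH] /=; first exact: x0.
rewrite subr_ge0 mix_norm//.
- exact: caps_ge0 pq.
- by have [] := pq n.
- exact: feed_ge0.
Qed.

Lemma carryS (R : realFieldType) (p q x : nat -> R) n :
  carry p q x n + feed p x n = `|emit p q x n| + carry p q x n.+1.
Proof. by rewrite /= [RHS]addrC subrK. Qed.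

Lemma feed_sum (R : realFieldType) (p x : nat -> R) n :
  x 0 + \sum_(i < n) feed p x i = \sum_(i < (rank p n).+1) x i.
Proof.
elim: n => [|n IH]; first by rewrite /rank !big_ord0 big_ord1 addr0.
rewrite big_ord_recr/= addrA IH rankS /feed; case: eqP => _ /=.
  by rewrite addr0 addn0.
by rewrite addn1 [in RHS]big_ord_recr.
Qed.

(** Telescoping of [carryS]: the mass consumed so far is either emitted or still carried. *)
Lemma carry_sum (R : realFieldType) (p q x : nat -> R) n :
  \sum_(i < n) `|emit p q x i| + carry p q x n =
  \sum_(i < (rank p n).+1) x i.
Proof.
rewrite -feed_sum; elim: n => [|n IH]; first by rewrite !big_ord0 addrC.
by rewrite !big_ord_recr/= -addrA -carryS addrA IH addrA.
Qed.

Lemma carry_feed_le1 (R : realFieldType) (p q x : nat -> R) n :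
  submass x -> carry p q x n + feed p x n <= 1.
Proof.
move=> [_ /(_ (rank p n.+1).+1)]; rewrite -(carry_sum _ q).
rewrite big_ord_recr/= -addrA -carryS; apply: le_trans.
by rewrite lerDr sumr_ge0.
Qed.

Lemma emit_le (R : realFieldType) (p q x : nat -> R) n :
  caps p q -> submass x -> - q n <= emit p q x n <= p n.
Proof.
move=> pq [x0 _]; have p0 := caps_ge0 n pq; have [q0 _ _] := pq n.
have c0 := carry_ge0 n pq x0; have f0 := feed_ge0 p n x0.
have := mix_le p0 q0 c0 f0; have := mix_le q0 p0 f0 c0.
by rewrite mixC !le_min lerNl => /andP[-> _] /andP[-> _].
Qed.

(** By [mix_ge] each term is at most [|emit| + feed], and the emitted mass and the fed mass are each
    at most the total mass 1. *)
Lemma sum_carry_le2 (R : realFieldType) (p q x : nat -> R) n :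
  caps p q -> submass x -> \sum_(i < n) carry p q x i * p i <= 2.
Proof.
move=> pq sx; have [x0 x1] := sx.
apply: (@le_trans _ _ (\sum_(i < n) (`|emit p q x i| + feed p x i))).
  apply: ler_sum => i _; have [q0 _ p1] := pq i.
  rewrite -lerBlDr; apply: le_trans (ler_norm _).
  apply: mix_ge => //; first by rewrite (caps_ge0 _ pq).
  - exact: carry_ge0.
  - exact: feed_ge0.
  - exact: carry_feed_le1.
rewrite big_split/=.
have := x1 (rank p n).+1; have := carry_sum p q x n; have := feed_sum p x n.
have := carry_ge0 n pq x0; have := x0 0%N; lra.
Qed.

(** Every coordinate gets consumed: as [p i <= 1], the rank dominates the partial sums of [p] and so
    passes [k]; growing by at most one per stage, it leaves [k] at a stage with [p n != 0]. *)
Lemma rank_onto (R : realFieldType) (p q : nat -> R) k :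
  caps p q -> unbounded_sum p -> exists2 n, rank p n = k & p n != 0.
Proof.
move=> pq /(_ k%:R)[n].
have : \sum_(i < n) p i <= (rank p n)%:R.
  rewrite /rank natr_sum ler_sum// => i _; case: eqP => [->//|_] /=.
  by have [] := pq i.
move=> /lt_le_trans/[apply]; rewrite ltr_nat.
elim: n => [|n IH]; first by rewrite /rank big_ord0.
have [/IH//|nk] := ltnP k (rank p n); rewrite rankS => kn.
by exists n; move: kn; case: (p n != 0) => //=; lia.
Qed.

(** * Decay of the carry and injectivity *)

(** The carry is a difference of two bounded nondecreasing sequences, so it converges; a positive
    limit would make the sum in [sum_carry_le2] diverge along with that of [p]. *)
Lemma carry_cvg0 (R : realType) (p q x : nat -> R) :
  caps p q -> unbounded_sum p -> submass x -> carry p q x @ \oo --> 0.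
Proof.
move=> pq up sx; have [x0 x1] := sx.
pose u n := \sum_(i < n) `|emit p q x i|.
pose v n := \sum_(i < (rank p n).+1) x i.
have vE n : carry p q x n = v n - u n.
  by rewrite /v -(carry_sum p q) addrC addKr.
have cu : cvgn u.
  apply: nondecreasing_is_cvgn.
    by apply/nondecreasing_seqP => n; rewrite /u big_ord_recr lerDl.
  exists 1 => _ [n _ <-]; apply: le_trans (x1 (rank p n).+1).
  by rewrite -(carry_sum p q) lerDl carry_ge0.
have cv : cvgn v.
  apply: nondecreasing_is_cvgn.
    apply/nondecreasing_seqP => n.
    by rewrite /v -!feed_sum lerD2l big_ord_recr lerDl feed_ge0.
  by exists 1 => _ [n _ <-]; exact: x1.
have cl : carry p q x @ \oo --> limn v - limn u.
  by rewrite (funext vE); exact: cvgB.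
set l := limn v - limn u in cl.
have : 0 <= l.
  rewrite -(cvg_lim (@Rhausdorff R) cl).
  by apply: limr_ge; [exact: cvgP cl|near=> n; exact: carry_ge0].
rewrite le_eqVlt => /predU1P[l0|l0]; [by rewrite l0|exfalso].
have [M _ Ml] : \forall n \near \oo, l / 2 < carry p q x n.
  by apply: cvgr_gt cl _ _; lra.
(* [M] covers the stages before the carry stays above [l / 2]; the excess [4 / l], weighted by
   [l / 2], gives the bound 2. *)
have [n] := up (M%:R + 4 / l); apply/negP; rewrite -leNgt.
suff : (\sum_(i < n) p i - M%:R) * (l / 2) <= 2.
  by move=> S2; rewrite -lerBlDl ler_pdivlMr//; lra.
apply: le_trans (sum_carry_le2 n pq sx).
elim: n => [|n IH].
  by rewrite !big_ord0 sub0r mulNr oppr_le0 mulr_ge0// divr_ge0 ?ltW.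
have p0 := caps_ge0 n pq; have c0 := carry_ge0 n pq x0.
rewrite !big_ord_recr/=.
(* From [M] on, each new term is at least [p n * (l / 2)]; before that, [p <= 1] makes the left side
   nonpositive. *)
have [Mn|nM] := leqP M n.
  have := Ml _ Mn; nra.
apply: (@le_trans _ _ 0); last first.
  rewrite addr_ge0 ?mulr_ge0// sumr_ge0// => i _.
  by rewrite mulr_ge0 ?carry_ge0// (caps_ge0 _ pq).
rewrite mulr_le0_ge0 ?divr_ge0 ?(ltW l0)// subr_le0.
have -> : \sum_(i < n) p i + p n = \sum_(i < n.+1) p i by rewrite big_ord_recr.
apply: (@le_trans _ _ n.+1%:R); last by rewrite ler_nat.
have -> : n.+1%:R = \sum_(i < n.+1) 1 :> R by rewrite sumr_const card_ord.
by apply: ler_sum => i _; have [] := pq i.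
Unshelve. all: by end_near. Qed.

Lemma emit_inj (R : realType) (p q x x' : nat -> R) :
  caps p q -> unbounded_sum p -> submass x -> submass x' ->
  emit p q x =1 emit p q x' -> x =1 x'.
Proof.
move=> pq up sx sx' E; have [x0 _] := sx; have [x'0 _] := sx'.
have step n : `|carry p q x n - carry p q x' n|
              <= `|carry p q x n.+1 - carry p q x' n.+1| /\
              (carry p q x n = carry p q x' n ->
               carry p q x n.+1 = carry p q x' n.+1 ->
               feed p x n = feed p x' n).
  have q0 : 0 <= q n by have [] := pq n.
  have := carryS p q x n; have := carryS p q x' n; rewrite -E.
  have := E n; rewrite {1 2}/emit.
  have := carry_ge0 n pq x0; have := carry_ge0 n pq x'0.
  have := feed_ge0 p n x0; have := feed_ge0 p n x'0.
  move: (carry p q x n) (carry p q x' n) (carry p q x n.+1) (carry p q x' n.+1).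
  move: (`|emit p q x n|) => w z z' y y'.
  have [pn|/eqP pn] := eqVneq (p n) 0.
    rewrite /feed pn eqxx !addr0 => _ _ _ _ _ e1 e2; split=> //.
    by rewrite e1 e2 opprD addrACA subrr add0r.
  have p0 : 0 < p n by rewrite lt_neqAle eq_sym (caps_ge0 _ pq) andbT; apply/eqP.
  move: (feed p x n) (feed p x' n) => f f' f'0 f0 z'0 z0 Em e' e.
  split; last by move=> ? ?; lra.
  (* Since the same [w] is emitted, [y] and [y'] are ordered as [z + f] and [z' + f']. Then
     [y' - y = (z' - z) + (f' - f)] with both summands of the same sign. *)
  have [yy|/ltW yy] := leP y y'.
    have [|zz ff] := mix_mono p0 q0 z0 f0 z'0 f'0 Em; first by lra.
    by rewrite !ler0_norm; lra.
  have [|zz ff] := mix_mono p0 q0 z'0 f'0 z0 f0 (esym Em); first by lra.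
  by rewrite !ger0_norm; lra.
have ce n : carry p q x n = carry p q x' n.
  apply/eqP; rewrite -subr_eq0 -normr_le0.
  have cd : `|carry p q x m - carry p q x' m| @[m --> \oo] --> (0 : R).
    rewrite -(normr0 R) -[in `|0|](subr0 0).
    by apply: cvg_norm; apply: cvgB; exact: carry_cvg0.
  rewrite -(cvg_lim (@Rhausdorff R) cd); apply: limr_ge; first exact: cvgP cd.
  exists n => // m /= /subnKC <-; elim: (m - n)%N => [|k IH].
    by rewrite addn0.
  by apply: le_trans IH _; rewrite addnS; case: (step (n + k)%N).
have fe n : feed p x n = feed p x' n by case: (step n) => _; exact.
case=> [|k]; first exact: (ce 0%N).
have [n <- pn] := rank_onto k pq up.
by have := fe n; rewrite /feed (negbTE pn).
Qed.

(** * Attaining finite prefixes *)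

(** Causality: changing coordinates not yet consumed leaves the earlier stages intact. *)
Lemma carry_local (R : realFieldType) (p q x x' : nat -> R) n :
  (forall k, (k <= rank p n)%N -> x k = x' k) ->
  carry p q x n = carry p q x' n.
Proof.
elim: n => [|n IH] xx' /=; first exact: xx'.
have -> : carry p q x n = carry p q x' n.
  by apply: IH => k kn; apply: xx'; rewrite (leq_trans kn)// rank_homo.
suff -> : feed p x n = feed p x' n by [].
rewrite /feed; case: eqP => // /eqP pn; apply: xx'.
by rewrite rankS pn addn1.
Qed.

Lemma emit_local (R : realFieldType) (p q x x' : nat -> R) n i :
  (forall k, (k <= rank p n)%N -> x k = x' k) -> (i < n)%N ->
  emit p q x i = emit p q x' i.
Proof.
move=> xx' i_n; have ri := rank_homo p i_n.
have il k : (k <= rank p i)%N -> x k = x' k.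
  by move=> ki; apply: xx'; move: ri; rewrite rankS; lia.
rewrite /emit (carry_local _ il) /feed; case: eqP => // /eqP pi0.
by rewrite xx'//; move: ri; rewrite rankS pi0 addn1.
Qed.

(** The final carry [s] is arbitrary so that the induction can run backwards: [mix_surj] converts
    [w n] and [s] into a coordinate [f] and an earlier carry [z], which the induction hypothesis
    attains. *)
Lemma emit_prefix (R : realFieldType) (p q w : nat -> R) n (s : R) :
  caps p q -> (forall i, - q i <= w i <= p i) -> 0 <= s ->
  exists x : nat -> R,
    [/\ forall k, 0 <= x k,
        forall k, (rank p n < k)%N -> x k = 0,
        forall i, (i < n)%N -> emit p q x i = w i
      & carry p q x n = s].
Proof.
move=> pq wb; elim: n s => [|n IH] s s0.
  by exists (fun k => if k is 0%N then s else 0); split=> // -[].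
have q0 : 0 <= q n by have [] := pq n.
have [pn|pn] := eqVneq (p n) 0.
  have w0 : w n = 0.
    have [_ qp _] := pq n; have /andP[? ?] := wb n.
    by apply/le_anti; rewrite -{2}pn; move: qp; lra.
  have qn : q n = 0 by apply/le_anti; rewrite q0 -pn; have [_ ->] := pq n.
  have [x [x0 xr xw xs]] := IH _ s0.
  have en : emit p q x n = 0 by rewrite /emit /mix pn qn !share0 !mulr0 subr0.
  exists x; split=> //.
  - by rewrite rankS pn eqxx addn0.
  - by move=> i; rewrite ltnS leq_eqVlt => /predU1P[->|/xw//]; rewrite en.
  - have := carryS p q x n.
    by rewrite en normr0 add0r /feed pn eqxx addr0 xs.
have p0 : 0 < p n by rewrite lt_neqAle eq_sym pn (caps_ge0 _ pq).
have [z [f [z0 f0 zf zfs]]] := mix_surj p0 q0 (wb n) s0.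
have [x [x0 xr xw xz]] := IH _ z0.
(* Stage [n] consumes exactly this coordinate, and no earlier stage sees it. *)
pose x' k := if k == (rank p n).+1 then f else x k.
have xx' k : (k <= rank p n)%N -> x' k = x k.
  by rewrite /x'; case: eqP => // ->; rewrite ltnn.
have fE : feed p x' n = f by rewrite /feed (negbTE pn) /x' eqxx.
have en : emit p q x' n = w n by rewrite /emit (carry_local _ xx') xz fE.
exists x'; split.
- by move=> k; rewrite /x'; case: eqP.
- move=> k; rewrite rankS pn addn1 => kn; rewrite /x' gtn_eqF// xr//.
  exact: ltnW.
- move=> i; rewrite ltnS leq_eqVlt => /predU1P[->//|i_n].
  by rewrite (emit_local _ xx' i_n) xw.
- have := carryS p q x' n; rewrite fE (carry_local _ xx') xz en zfs.
  by move/addrI.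
Qed.

(** With final carry 0, the mass of [x] equals the emitted mass, since [x] vanishes beyond
    [rank p n]. *)
Lemma submass_prefix (R : realFieldType) (p q w : nat -> R) n :
  caps p q -> (forall i, - q i <= w i <= p i) ->
  \sum_(i < n) `|w i| <= 1 ->
  exists2 x, submass x & forall i, (i < n)%N -> emit p q x i = w i.
Proof.
move=> pq wb w1; have [x [x0 xr xw xs]] := emit_prefix n pq wb (lexx 0).
exists x => //; split=> // m.
have xn : \sum_(i < (rank p n).+1) x i <= 1.
  rewrite -(carry_sum p q) xs addr0 (eq_bigr (fun i : 'I_n => `|w i|))// => i _.
  by rewrite xw.
have [mn|/ltnW nm] := leqP m (rank p n).+1.
  apply: le_trans xn; rewrite -(subnKC mn) big_split_ord/= lerDl.
  exact: sumr_ge0.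
rewrite -(subnKC nm) big_split_ord/= [X in _ + X]big1 ?addr0// => i _.
by rewrite xr//; exact: leq_addr.
Qed.

(** * Preservation of the sum *)

Lemma nneseries_EFin_leP (R : realType) (f : nat -> R) (r : R) :
  (forall n, 0 <= f n) ->
  (\sum_(0 <= n <oo) (f n)%:E <= r%:E)%E <->
  forall n, \sum_(i < n) f i <= r.
Proof.
move=> f0; have fE n : (\sum_(0 <= i < n) (f i)%:E)%E = (\sum_(i < n) f i)%:E.
  by rewrite big_mkord sumEFin.
split=> [fr n|fr].
  rewrite -lee_fin -fE; apply: le_trans fr.
  by apply: nneseries_lim_ge => i _ _; rewrite lee_fin.
apply: lime_le; first by apply: is_cvg_nneseries => i _ _; rewrite lee_fin.
by apply: nearW => n; rewrite fE lee_fin.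
Qed.

Lemma emit_norm (R : realType) (p q x : nat -> R) :
  caps p q -> unbounded_sum p -> submass x ->
  (\sum_(0 <= n <oo) `|emit p q x n|%:E = \sum_(0 <= n <oo) (x n)%:E)%E.
Proof.
move=> pq up sx; have [x0 x1] := sx; apply/le_anti/andP; split.
  have : (0 <= \sum_(0 <= n <oo) (x n)%:E)%E.
    by apply: nneseries_ge0 => i _ _; rewrite lee_fin.
  have : (\sum_(0 <= n <oo) (x n)%:E <= 1%:E)%E by exact/nneseries_EFin_leP.
  case E : (\sum_(0 <= n <oo) (x n)%:E)%E => [s| |]// _ _.
  have /(nneseries_EFin_leP s x0) xs : (\sum_(0 <= n <oo) (x n)%:E <= s%:E)%E.
    by rewrite E.
  apply/nneseries_EFin_leP => // n; apply: le_trans (xs (rank p n).+1).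
  by rewrite -(carry_sum p q) lerDl carry_ge0.
apply: lime_le; first by apply: is_cvg_nneseries => i _ _; rewrite lee_fin.
apply: nearW => n; rewrite big_mkord sumEFin.
apply/lee_addgt0Pr => e e0.
have [m mn _] := rank_onto n pq up.
have [M _ Me] : \forall k \near \oo, carry p q x k < e.
  by apply: cvgr_lt (carry_cvg0 pq up sx) _ _.
(* Late enough that the first [n] coordinates have been consumed and the carry is below [e]. *)
pose k := maxn m M.
have mk : (n <= rank p k)%N by rewrite -mn rank_homo// leq_maxl.
have ck : carry p q x k < e by apply: Me; exact: leq_maxr.
apply: (@le_trans _ _ (\sum_(i < k) `|emit p q x i| + e)%:E); last first.
  rewrite EFinD leeD2r// -sumEFin.
  rewrite -(big_mkord xpredT (fun i => `|emit p q x i|%:E)).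
  by apply: nneseries_lim_ge => i _ _; rewrite lee_fin.
rewrite lee_fin; apply: (@le_trans _ _ (\sum_(i < (rank p k).+1) x i)).
  rewrite -(subnKC (leqW mk)) big_split_ord/= lerDl.
  exact: sumr_ge0.
by rewrite -(carry_sum p q) lerD2l ltW.
Qed.

(** * Continuity of the stages *)

Lemma share_continuous (R : realType) (c : R) :
  0 <= c -> continuous (share c : R -> R).
Proof.
rewrite le_eqVlt => /predU1P[<-|c0] r.
  rewrite (_ : share 0 = cst 0); first exact: cvg_cst.
  by apply/funext => s; rewrite share0.
apply: cvgM; first exact: cvg_cst.
apply: cvgV; first by rewrite gt_eqF// lt_max c0.
by apply: (@continuous_max R R (cst c) id); [exact: cvg_cst|exact: cvg_id].
Qed.

Lemma mix_continuous (R : realType) (T : topologicalType) (p q : R)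
    (z x : T -> R) :
  0 <= p -> 0 <= q -> continuous z -> continuous x ->
  continuous (fun t => mix p q (z t) (x t)).
Proof.
move=> p0 q0 cz cx t.
have cs c : 0 <= c -> (share c (z s + x s) @[s --> t] --> share c (z t + x t)).
  move=> c0; apply: (@continuous_comp _ _ _ (fun s => z s + x s) (share c)).
    by apply: cvgD; [exact: cz|exact: cx].
  exact: share_continuous.
by apply: cvgB; apply: cvgM; [exact: cz|exact: cs|exact: cx|exact: cs].
Qed.

Lemma feed_continuous (R : realType) (T : topologicalType) (p : nat -> R)
    (x : T -> nat -> R) n :
  (forall k, continuous (x^~ k)) -> continuous (fun t => feed p (x t) n).
Proof.
move=> cx t; rewrite /feed; case: eqP => _; [exact: cvg_cst|exact: cx].
Qed.

Lemma carry_continuous (R : realType) (T : topologicalType) (p q : nat -> R)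
    (x : T -> nat -> R) n :
  caps p q -> (forall k, continuous (x^~ k)) ->
  continuous (fun t => carry p q (x t) n).
Proof.
move=> pq cx; elim: n => [|n IH] t /=; first exact: cx.
have cf : continuous (fun t => feed p (x t) n) by exact: feed_continuous.
apply: cvgB; first by apply: cvgD; [exact: IH|exact: cf].
apply: cvg_norm; apply: mix_continuous IH cf t.
  exact: caps_ge0 pq.
by have [] := pq n.
Qed.

Lemma emit_continuous (R : realType) (T : topologicalType) (p q : nat -> R)
    (x : T -> nat -> R) n :
  caps p q -> (forall k, continuous (x^~ k)) ->
  continuous (fun t => emit p q (x t) n).
Proof.
move=> pq cx; apply: mix_continuous.
- exact: caps_ge0 pq.
- by have [] := pq n.
- exact: carry_continuous.
- exact: feed_continuous.
Qed.

(** * Pointwise convergence and compactness of the domain *)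

Lemma ptws_coord_continuous (R : realType) (k : nat) :
  continuous ((fun x => x k) : {ptws nat -> R} -> R).
Proof. exact: (@proj_continuous nat (fun=> R) k). Qed.

Lemma ptws_cvg (R : realType) (T : Type) (F : set_system T)
    (f : T -> {ptws nat -> R}) (y : {ptws nat -> R}) :
  Filter F -> (forall k, f t k @[t --> F] --> y k) -> f @ F --> y.
Proof.
move=> FF fy; apply/cvg_sup => k; apply/cvg_image.
  by apply/seteqP; split=> // r _; exists (fun=> r).
move=> B /fy; rewrite /= !nbhs_simpl => FB.
exists ((fun x => x k) @^-1` B) => //.
apply/seteqP; split=> [_ [x /= Bx <-//]|r Br].
by exists (fun=> r).
Qed.

Lemma BplusP (R : realType) (x : nat -> R) : Bplus R x <-> submass x.
Proof.
split=> [[x01 x1]|[x0 x1]].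
  have x0 n : 0 <= x n by have /andP[] := x01 n.
  by split=> //; apply/nneseries_EFin_leP.
split=> [n|]; last exact/nneseries_EFin_leP.
rewrite x0/=; apply: le_trans (x1 n.+1).
by rewrite big_ord_recr/= lerDr sumr_ge0.
Qed.

(** A closed part of the Tychonoff cube. The bound is imposed on finite partial sums, since the full
    series is not continuous for pointwise convergence. *)
Lemma Bplus_compact (R : realType) : compact (Bplus R).
Proof.
have -> : Bplus R = [set x | forall k, `[0, 1]%classic (x k)]
    `&` \bigcap_(n in setT) [set x : {ptws nat -> R} | \sum_(i < n) x i <= 1].
  apply/seteqP; split=> [x Bx|x [x01 x1]].
    have /BplusP[_ x1] := Bx; have [x01 _] := Bx.
    split=> [k|n _]; last exact: x1.
    by rewrite /= in_itv/=; exact: x01.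
  apply/BplusP; split=> n; last exact: x1.
  by have := x01 n; rewrite /= in_itv/= => /andP[].
apply: compact_closedI.
  apply: (@tychonoff nat (fun=> R) (fun=> `[0, 1]%classic)) => k.
  exact: segment_compact.
apply: closed_bigI => n _.
have cs : continuous (fun x : {ptws nat -> R} => \sum_(i < n) x i).
  apply: continuous_big => [|i _]; first exact: add_continuous.
  exact: ptws_coord_continuous.
exact: (iffLR (continuous_closedP _) cs _ (@closed_le R 1)).
Qed.

(** * The homeomorphism for general bounds *)

Local Open Scope ereal_scope.

Theorem theorem2 (R : realType) (a b : nat -> R)
  (ha : forall n, (-1 <= a n <= 1)%R) (hb : forall n, (-1 <= b n <= 1)%R)
  (hab : forall n, (a n <= 0 <= b n)%R)
  (hsum : \sum_(0 <= n <oo) (Num.max (- a n)%R (b n))%:E = +oo) :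
  exists F : Bplus R -> Bab a b,
    homeomorphism F /\
    forall x : Bplus R,
      \sum_(0 <= n <oo) `|val (F x) n|%:E = \sum_(0 <= n <oo) (val x n)%:E.
Proof.
pose p n := Num.max (- a n)%R (b n); pose q n := Num.min (- a n)%R (b n).
(* The sign [e n] flips the coordinates where [- a n] is the larger bound, so that the interval
   becomes [[- q n, p n]]. *)
pose e n : R := if (- a n <= b n)%R then 1%R else (-1)%R.
have e_norm n : `|e n|%R = 1%R.
  by rewrite /e; case: ifP; rewrite ?normrN normr1.
have eK n (y : R) : (e n * (e n * y) = y)%R.
  by rewrite /e; case: ifP; rewrite ?mulNr ?mul1r ?opprK.
have pq : caps p q.
  move=> n; have /andP[an0 bn0] := hab n; have /andP[an1 _] := ha n.
  have /andP[_ bn1] := hb n.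
  by rewrite /p /q; case: (leP (- a n)%R (b n)) => ?; split; lra.
have p0 n : (0 <= p n)%R by exact: caps_ge0 pq.
have up : unbounded_sum p.
  move=> A; apply: contrapT => /forallNP nA.
  suff : \sum_(0 <= n <oo) (p n)%:E <= A%:E by rewrite hsum.
  by apply/nneseries_EFin_leP => // n; rewrite leNgt; apply/negP/nA.
have ab_pq n (w : R) : (a n <= e n * w <= b n)%R = (- q n <= w <= p n)%R.
  rewrite /e /p /q; case: (leP (- a n)%R (b n)) => _.
    by rewrite mul1r opprK.
  by rewrite mulN1r lerNl lerNr andbC.
pose G (x : {ptws nat -> R}) : {ptws nat -> R} :=
  fun n => (e n * emit p q x n)%R.
have G_norm x : submass x ->
    \sum_(0 <= n <oo) `|G x n|%:E = \sum_(0 <= n <oo) (x n)%:E.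
  move=> sx; rewrite -(emit_norm pq up sx); apply: eq_eseriesr => n _.
  by rewrite normrM e_norm mul1r.
have sval_Bplus (x : Bplus R) : submass (val x).
  exact/BplusP/(set_mem (valP x)).
have GB (x : Bplus R) : Bab a b (G (val x)).
  split=> [|n]; last by rewrite ab_pq emit_le.
  by rewrite G_norm//; have [] := set_mem (valP x).
pose F (x : Bplus R) : Bab a b := exist _ (G (val x)) (mem_set (GB x)).
have coord_cont k : continuous (fun x : Bplus R => val x k).
  move=> x; apply: (@continuous_comp (Bplus R) {ptws nat -> R} R val (@^~ k)).
    exact: initial_continuous.
  exact: ptws_coord_continuous.
have emit_cont k : continuous (fun x : Bplus R => emit p q (val x) k).
  exact: emit_continuous.
have F_cont : continuous F.
  apply: continuous_set_type => x.
  apply: (@ptws_cvg _ _ (nbhs x) _ _ (nbhs_filter x)) => k.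
  apply: cvgM; [exact: cvg_cst|exact: emit_cont].
have F_inj : injective F.
  move=> x x' /(congr1 val) /= E; apply/val_inj/funext.
  apply: (emit_inj pq up) => // n.
  by rewrite -[LHS](eK n) -[RHS](eK n); congr (_ * _)%R; exact: (congr1 (@^~ n) E).
have hausX : hausdorff_space {ptws nat -> R}.
  by apply: hausdorff_product => k; exact: Rhausdorff.
have cB := compact_set_type (@Bplus_compact R).
have F_surj y : exists x, F x = y.
  have [+ yab] := set_mem (valP y).
  move=> /nneseries_EFin_leP y1.
  (* Images agreeing with [y] on longer and longer prefixes converge to [y] pointwise; the image of
     [F] is compact, hence closed, so it contains [y]. *)
  have yn (n : nat) : exists x : Bplus R,
      forall i, (i < n)%N -> val (F x) i = val y i.
    have [i|| x sx xy] := @submass_prefix _ p q (fun i => (e i * val y i)%R) n pq.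
    - by rewrite -ab_pq eK.
    - under eq_bigr do rewrite normrM e_norm mul1r.
      exact: y1.
    - exists (exist _ x (mem_set (iffRL (BplusP x) sx))) => i i_n.
      by rewrite /= /G xy.
  have [x xy] := choice yn.
  have cl : closed [set val (F x) | x in [set: Bplus R]].
    apply: compact_closed => //; apply: continuous_compact => //.
    apply: continuous_subspaceT => z.
    apply: (@continuous_comp _ _ {ptws nat -> R} F val); first exact: F_cont.
    exact: initial_continuous.
  have xF : val (F (x n)) @[n --> \oo] --> val y.
    apply: ptws_cvg => k; apply: cvg_near_cst.
    by exists k.+1 => // n /= kn; exact: xy.
  have [|z _ zy] := closed_cvg _ cl _ _ xF.
    by apply: nearW => n; exists (x n).
  by exists z; exact: val_inj.
exists F; split; last by move=> x; exact: G_norm.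
apply: homeomorphism_compact_hausdorff => //.
  exact: hausdorff_set_type.
have [g gK] := choice F_surj.
by exists g => // x; apply: F_inj; rewrite gK.
Qed.
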